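(* Let $X$ and $Y$ be two independent real-valued random variables. Suppose that the random vector $(X,Y)^{\mathrm{T}}$ has a spherically symmetric distribution. Then $X$ and $Y$ are identically distributed as a normal distribution with mean $0$ (and possibly variance $0$); that is, there exists $\sigma^2 \in [0,\infty)$ such that both $X$ and $Y$ have distribution $N(0,\sigma^2)$.
   Context: A random vector $\mathbf{X}$ taking values in $\mathbb{R}^n$ is said to have a spherically symmetric distribution if $\mathbf{X}$ and $\mathbf{H}\mathbf{X}$ have the same distribution for every $n \times n$ real orthogonal matrix $\mathbf{H}$. The normal distribution with mean $0$ and variance $0$ is the point mass at $0$. *)

(* Defs.v *)
From mathcomp Require Import all_boot all_order all_algebra.
From mathcomp Require Import all_classical all_reals all_analysis.

Set Implicit Arguments.
Unset Strict Implicit.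
Unset Printing Implicit Defensive.

Import Order.TTheory GRing.Theory Num.Theory.
Import numFieldNormedType.Exports.

Local Open Scope classical_set_scope.
Local Open Scope ring_scope.

Definition orthogonal_mx (R : realType) (n : nat) (H : 'M[R]_n) : Prop :=
  H^T *m H = 1%:M.

Definition borel_cV (R : realType) (n : nat) : set (set 'cV[R]_n) :=
  <<s open >>.

(* Laws are compared on Borel sets only: the value of the set function [P] on
   a non-measurable set is meaningless. *)
Definition same_distribution d (T : measurableType d) (R : realType)
    (P : probability T R) (n : nat) (U V : T -> 'cV[R]_n) : Prop :=
  forall B, borel_cV B -> P (U @^-1` B) = P (V @^-1` B).

(* A random vector of R^n is given by its n coordinates, real random
   variables on a common probability space. *)
Definition random_col d (T : measurableType d) (R : realType)
    (P : probability T R) (n : nat) (X : 'I_n -> {RV P >-> R})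
    (w : T) : 'cV[R]_n := \col_i X i w.

Definition spherically_symmetric d (T : measurableType d) (R : realType)
    (P : probability T R) (n : nat) (X : 'I_n -> {RV P >-> R}) : Prop :=
  forall H : 'M[R]_n, orthogonal_mx H ->
    same_distribution P (random_col X) (fun w => H *m random_col X w).

Definition independent_RV2 d (T : measurableType d) (R : realType)
    (P : probability T R) (X Y : {RV P >-> R}) : Prop :=
  forall A B : set R, measurable A -> measurable B ->
    P (X @^-1` A `&` Y @^-1` B) = (P (X @^-1` A) * P (Y @^-1` B))%E.

(* N(m, v), parametrized by the variance [v]. The second parameter of the
   library's [normal_prob] is the standard deviation, and [normal_prob m 0] is
   the uniform law on [0, 1], so the degenerate case is treated apart. *)
Definition normal_law (R : realType) (m v : R) :
    probability (measurableTypeR R) R :=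
  if v == 0 then (@dirac _ (measurableTypeR R) m R : probability _ R)
  else (normal_prob m (Num.sqrt v) : probability _ R).

Definition has_distribution d (T : measurableType d) (R : realType)
    (P : probability T R) (X : {RV P >-> R})
    (mu : probability (measurableTypeR R) R) : Prop :=
  forall A : set R, measurable A -> distribution P X A = mu A.

(* Main.v *)
Require Import Defs.
From HB Require Import structures.
From mathcomp Require Import all_boot all_order all_algebra.
From mathcomp Require Import all_classical all_reals all_analysis.
From mathcomp Require Import measurable_realfun.
From mathcomp Require Import ring lra.

Set Implicit Arguments.
Unset Strict Implicit.
Unset Printing Implicit Defensive.

Import Order.TTheory GRing.Theory Num.Theory.
Import numFieldNormedType.Exports.

Local Open Scope classical_set_scope.
Local Open Scope ring_scope.

(** Rotation invariance and independence together force the Gaussian shape.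
    For t > 0 let g_t(x) = E exp(-t (X - x)^2). The random vector (X, Y) has
    coordinates of the same law, so by independence g_t(p) g_t(q) is the
    expectation of exp(-t |(X, Y) - (p, q)|^2); by spherical symmetry this
    depends on (p, q) only through its length, whence
      g_t(p) g_t(q) = g_t(sqrt(p^2 + q^2)) g_t(0)
    ([gauss_avg_radial]). As g_t is positive and bounded, this functional
    equation has only the solutions g_t(x) = g_t(0) exp(-a x^2) with a >= 0
    ([radial_product_gaussian]): u |-> ln (g_t(sqrt u) / g_t(0)) is additive
    and bounded above on the half-line.

    Smoothing by a Gaussian replaces the unknown law by a positive bounded
    function, to which a functional equation can be applied at every point. The
    dependence of a on t is found by integrating g_t against
    exp(-r x^2) in two ways: from the explicit form of g_t, and by exchanging
    the integrals and completing the square ([integral_gauss_avg_gauss]). This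
    gives, with L(s) = g_s(0) = E exp(-s X^2),
      L(t r / (t + r))^2 (a + r) = L(t)^2 (t + r),
    which forces L(s) = 1 / sqrt(1 + s c) for some constant c >= 0
    ([gauss_avg0_gaussian]). This is the same function as for N(0, c / 2)
    ([gauss_avg_normal_law]).

    It remains to see that L determines the law. The values of L at the
    multiples of m are the moments of exp(-m X^2), so they determine the
    expectation of (1 - exp(-m X^2))^k; for a suitable k = k(m) these functions
    tend to the indicator of X^2 > r, so L determines the law of X^2
    ([sq_law_unique]). Since X and -X have the same law, as do the variables of
    law N(0, c / 2), this determines the law of X
    ([symmetric_probability_unique]). *)

(** * Positive functions whose tensor square is radial *)

Lemma additive_natmul (R : realType) (psi : R -> R) :
  (forall u v, 0 <= u -> 0 <= v -> psi (u + v) = psi u + psi v) ->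
  forall n v, 0 <= v -> psi (n%:R * v) = n%:R * psi v.
Proof.
move=> psiD n v v0; elim: n => [|n IHn].
  by rewrite !mul0r; have := psiD 0 0 (lexx _) (lexx _); rewrite addr0; lra.
by rewrite -natr1 !mulrDl !mul1r psiD ?IHn// mulr_ge0.
Qed.

(** An additive function of constant sign on the half-line is monotone, which
    excludes the pathological solutions of the Cauchy equation: squeezing
    [n * u] between consecutive integers bounds the defect from linearity at
    [u] by a constant over [n]. *)
Lemma additive_nonpos_linear (R : realType) (psi : R -> R) :
  (forall u v, 0 <= u -> 0 <= v -> psi (u + v) = psi u + psi v) ->
  (forall u, 0 <= u -> psi u <= 0) ->
  forall u, 0 <= u -> psi u = u * psi 1.
Proof.
move=> psiD psi_le0 u u0.
have psiMn := additive_natmul psiD.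
have psi_ni v w : 0 <= v -> v <= w -> psi w <= psi v.
  move=> v0 vw; rewrite -(subrK v w) addrC psiD ?subr_ge0//.
  by rewrite gerDl psi_le0// subr_ge0.
have bnd n : n%:R * `|psi u - u * psi 1| <= - psi 1.
  rewrite -{1}(ger0_norm (ler0n R n)) -normrM mulrBr mulrA -psiMn//.
  have nu0 : 0 <= n%:R * u by rewrite mulr_ge0.
  have /andP[mn nm] := truncn_itv nu0; set m := Num.truncn _ in mn nm.
  have h1 : psi (n%:R * u) <= m%:R * psi 1.
    by rewrite -psiMn ?ler01// mulr1; exact: psi_ni.
  have h2 : m.+1%:R * psi 1 <= psi (n%:R * u).
    by rewrite -psiMn ?ler01// mulr1; apply: psi_ni => //; exact: ltW.
  have p1 := psi_le0 1 ler01.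
  move: h2 nm; rewrite -natr1 => h2 nm.
  rewrite ler_norml; apply/andP; split; nra.
apply/eqP; rewrite -subr_eq0 -normr_eq0; apply/negPn/negP => d0.
have dgt0 : 0 < `|psi u - u * psi 1| by rewrite lt_neqAle eq_sym d0 normr_ge0.
have := archi_boundP (_ : 0 <= - psi 1 / `|psi u - u * psi 1|).
rewrite divr_ge0// ?oppr_ge0 ?psi_le0// => /(_ isT).
by rewrite ltr_pdivrMr// ltNge bnd.
Qed.

(** The logarithm turns the equation into the Cauchy equation in the variable
    [u = x ^+ 2]. An additive function bounded above on the half-line is
    nonpositive there, since [psi (n * u) = n * psi u] would otherwise be
    unbounded; monotonicity then replaces continuity. *)
Lemma radial_product_gaussian (R : realType) (g : R -> R) :
  (forall x, 0 < g x) -> (forall x, g x <= 1) ->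
  (forall x y, g x * g y = g (Num.sqrt (x ^+ 2 + y ^+ 2)) * g 0) ->
  exists2 a, 0 <= a & forall x, g x = g 0 * expR (- (a * x ^+ 2)).
Proof.
move=> g0 g1 gM.
pose psi u := ln (g (Num.sqrt u) / g 0).
have q0 x : 0 < g x / g 0 by rewrite divr_gt0.
have psiD u v : 0 <= u -> 0 <= v -> psi (u + v) = psi u + psi v.
  move=> u0 v0; rewrite /psi -lnM ?posrE//; congr ln.
  have := gM (Num.sqrt u) (Num.sqrt v); rewrite !sqr_sqrtr// => E.
  by rewrite mulf_div E -mulf_div divff ?gt_eqF// mulr1.
have psiMn := additive_natmul psiD.
have psi_le0 u : 0 <= u -> psi u <= 0.
  move=> u0; rewrite leNgt; apply/negP => psi0.
  have C0 : 0 <= - ln (g 0) by rewrite oppr_ge0 ln_le0.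
  have := archi_boundP (divr_ge0 C0 (ltW psi0)).
  rewrite ltr_pdivrMr// -psiMn// /psi ltNge lnM ?posrE ?invr_gt0//.
  by rewrite lnV ?posrE// gerDr ln_le0.
exists (- psi 1); first by rewrite oppr_ge0 psi_le0.
move=> x; rewrite mulNr opprK.
(* The equation at [y = 0] makes [g] even, which covers negative [x]. *)
have -> : g x = g (Num.sqrt (x ^+ 2)).
  by apply: (mulIf (lt0r_neq0 (g0 0))); rewrite gM expr0n addr0.
rewrite (mulrC (psi 1)) -(additive_nonpos_linear (psi := psi))// ?sqr_ge0//.
by rewrite lnK ?posrE// mulrC divfK// gt_eqF.
Qed.

(** * Gaussian integrals *)

Lemma integral_itv01 d (T : measurableType d) (R : realType)
    (P : probability T R) (f : T -> R) : measurable_fun setT f ->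
  (forall x, 0 <= f x <= 1) ->
  (0 <= \int[P]_x (f x)%:E <= 1)%E.
Proof.
move=> mf f01; apply/andP; split.
  by apply: integral_ge0 => x _; rewrite lee_fin; case/andP: (f01 x).
rewrite -(probability_setT P) -[leRHS]mul1e -integral_cst//.
apply: ge0_le_integral => //.
- by move=> x _; rewrite lee_fin; case/andP: (f01 x).
- exact/measurable_EFinP.
- by move=> x _; rewrite lee_fin; case/andP: (f01 x).
Qed.

Lemma integrable_itv01 d (T : measurableType d) (R : realType)
    (P : probability T R) (f : T -> R) : measurable_fun setT f ->
  (forall x, 0 <= f x <= 1) -> P.-integrable setT (EFin \o f).
Proof.
move=> mf f01; apply/integrableP; split; first exact/measurable_EFinP.
under eq_integral => x _ do rewrite /= ger0_norm ?(andP (f01 x)).1//.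
by have /andP[_ /le_lt_trans] := integral_itv01 P mf f01; apply; rewrite ltry.
Qed.

Lemma integral_gt0 d (T : measurableType d) (R : realType)
    (P : probability T R) (f : T -> R) : measurable_fun setT f ->
  (forall x, 0 < f x) -> (0 < \int[P]_x (f x)%:E)%E.
Proof.
move=> mf f0; rewrite lt0e integral_ge0 ?andbT; last first.
  by move=> x _; rewrite lee_fin ltW.
apply/eqP => If0.
have /ae_eq_integral_abs : measurable_fun [set: T] (EFin \o f).
  exact/measurable_EFinP.
move=> /(_ P measurableT)[+ _].
under eq_integral => x _ do rewrite /= ger0_norm ?ltW//.
move=> /(_ If0)[N [mN N0 subN]].
have : P setT = 0%E.
  apply/eqP; rewrite eq_le measure_ge0 andbT -N0 le_measure ?inE//.
  move=> x _; apply: subN => /= /(_ I) /eqP; rewrite eqe.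
  by rewrite gt_eqF.
by rewrite probability_setT => /eqP; rewrite onee_eq0.
Qed.

Lemma integral_gauss (R : realType) (t m : R) : 0 < t ->
  (\int[lebesgue_measure]_x (expR (- (t * (x - m) ^+ 2)))%:E =
   (Num.sqrt (pi / t))%:E)%E.
Proof.
move=> t0; set s := Num.sqrt ((2 * t)^-1).
have s0 : s != 0 by rewrite gt_eqF// sqrtr_gt0 invr_gt0 mulr_gt0.
have s2 : s ^+ 2 = (2 * t)^-1.
  by rewrite sqr_sqrtr// invr_ge0 mulr_ge0// ltW.
have pE : normal_peak s = (Num.sqrt (pi / t))^-1.
  rewrite /normal_peak s2; congr (Num.sqrt _)^-1.
  by rewrite -mulr_natr; field; rewrite gt_eqF.
have fE x : normal_fun m s x = expR (- (t * (x - m) ^+ 2)).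
  rewrite /normal_fun s2; congr expR; rewrite -mulr_natr.
  by field; rewrite gt_eqF//; lra.
have := integral_normal_pdf m s; rewrite normal_pdfE//.
under eq_integral => x _ do rewrite fE pE EFinM.
rewrite ge0_integralZl//; last first.
  apply/measurable_EFinP; rewrite -(funext fE).
  exact: measurable_normal_fun.
have q0 : 0 < Num.sqrt (pi / t) by rewrite sqrtr_gt0 divr_gt0 ?pi_gt0.
by move=> /(congr1 (mule (Num.sqrt (pi / t))%:E)); rewrite muleA -EFinM divff
  ?gt_eqF// mul1e mule1.
Qed.

(** As a function of [x] this is, up to normalization, the density of the sum
    of a variable of law [mu] and an independent centred normal variable of
    variance [1 / (2 * t)]; as a function of [t] at [x = 0] it is the Laplace
    transform of the law of the square. *)
Definition gauss_avg (R : realType) (mu : probability R R)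
    (t x : R) : R :=
  fine (\int[mu]_y (expR (- (t * (y - x) ^+ 2)))%:E).

Lemma measurable_gauss (R : realType) (t x : R) :
  measurable_fun [set: R] (fun y => expR (- (t * (y - x) ^+ 2))).
Proof.
apply: measurableT_comp => //; apply: measurableT_comp => //.
by apply: measurable_funM => //; apply: measurable_funX; exact: measurable_funB.
Qed.

Lemma continuous_gauss (R : realType) (t x : R) :
  continuous (fun y => expR (- (t * (y - x) ^+ 2))).
Proof.
move=> y; apply: (cvg_comp _ expR); last exact: continuous_expR.
apply: (@cvgN _ R^o); apply: cvgM; first exact: cvg_cst.
apply: (cvg_comp (fun y => y - x) (fun y => y ^+ 2)).
  by apply: (@cvgB _ R^o); [exact: cvg_id|exact: cvg_cst].
exact: sqr_continuous.
Qed.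

Lemma gauss_itv01 (R : realType) (t x y : R) : 0 <= t ->
  0 <= expR (- (t * (y - x) ^+ 2)) <= 1.
Proof.
by move=> t0; rewrite expR_ge0/= -expR0 ler_expR oppr_le0 mulr_ge0// sqr_ge0.
Qed.

Section gauss_avg_theory.
Context (R : realType) (mu : probability R R).
Implicit Types t x r : R.

Lemma gauss_avgE t x : 0 <= t ->
  (\int[mu]_y (expR (- (t * (y - x) ^+ 2)))%:E = (gauss_avg mu t x)%:E)%E.
Proof.
move=> t0; have /andP[I0 I1] := integral_itv01 mu
  (measurable_gauss t x) (fun y => gauss_itv01 x y t0).
by rewrite fineK// ge0_fin_numE// (le_lt_trans I1)// ltry.
Qed.

Lemma gauss_avg_le1 t x : 0 <= t -> gauss_avg mu t x <= 1.
Proof.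
move=> t0; rewrite -lee_fin -gauss_avgE//.
by case/andP: (integral_itv01 mu
  (measurable_gauss t x) (fun y => gauss_itv01 x y t0)).
Qed.

Lemma gauss_avg_gt0 t x : 0 <= t -> 0 < gauss_avg mu t x.
Proof.
move=> t0; rewrite -lte_fin -gauss_avgE//.
by apply: integral_gt0 => [|y]; [exact: measurable_gauss|exact: expR_gt0].
Qed.

(** By Tonelli the integral in [x] can be taken first; the product of the two
    Gaussian kernels is then, up to a factor depending on [y] only, a Gaussian
    centred at [t * y / (t + r)]. *)
Lemma integral_gauss_avg_gauss t r : 0 < t -> 0 <= r ->
  (\int[lebesgue_measure]_x (gauss_avg mu t x * expR (- (r * x ^+ 2)))%:E =
   (gauss_avg mu (t * r / (t + r)) 0 * Num.sqrt (pi / (t + r)))%:E)%E.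
Proof.
move=> t0 r0; have tr0 : 0 < t + r by rewrite ltr_wpDr.
pose f (z : R * measurableTypeR R) :=
  (expR (- (t * (z.1 - z.2) ^+ 2)) * expR (- (r * z.2 ^+ 2)))%:E.
have mf : measurable_fun setT f.
  apply/measurable_EFinP; apply: measurable_funM.
    apply: measurableT_comp => //; apply: measurableT_comp => //.
    by apply: measurable_funM => //; apply: measurable_funX; exact: measurable_funB.
  apply: measurableT_comp => //; apply: measurableT_comp => //.
  by apply: measurable_funM => //; exact: measurable_funX.
have f0 z : (0 <= f z)%E by rewrite lee_fin mulr_ge0// expR_ge0.
transitivity (\int[lebesgue_measure]_x \int[mu]_y f (y, x))%E.
  apply: eq_integral => x _; rewrite /f/=.
  under eq_integral => y _ do rewrite EFinM.
  rewrite ge0_integralZr//; first by rewrite gauss_avgE// ltW.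
  by apply/measurable_EFinP; exact: measurable_gauss.
rewrite -(fubini_tonelli _ mf f0).
have s0 : 0 <= t * r / (t + r) by rewrite divr_ge0 ?mulr_ge0// ltW.
rewrite EFinM -gauss_avgE// -ge0_integralZr//; last first.
  by apply/measurable_EFinP; exact: measurable_gauss.
apply: eq_integral => y _; rewrite /f/=.
(* completing the square *)
have sqE x : expR (- (t * (y - x) ^+ 2)) * expR (- (r * x ^+ 2)) =
    expR (- (t * r / (t + r) * (y - 0) ^+ 2)) *
    expR (- ((t + r) * (x - t * y / (t + r)) ^+ 2)).
  by rewrite -!expRD; congr expR; field; rewrite gt_eqF.
under eq_integral => x _ do rewrite sqE EFinM.
rewrite ge0_integralZl//; last first.
  by apply/measurable_EFinP; exact: measurable_gauss.
by rewrite integral_gauss.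
Qed.

End gauss_avg_theory.

(** * Spherically symmetric pairs *)

Lemma integral_indep_mul d (T : measurableType d) (R : realType)
    (P : probability T R) (X Y : {RV P >-> R}) (f h : R -> R) :
  independent_RV2 X Y ->
  measurable_fun setT f -> measurable_fun setT h ->
  (forall x, 0 <= f x) -> (forall x, 0 <= h x) ->
  (\int[P]_w (f (X w) * h (Y w))%:E =
   \int[P]_w (f (X w))%:E * \int[P]_w (h (Y w))%:E)%E.
Proof.
move=> indep mf mh f0 h0.
pose XY w := (X w, Y w).
have mXY : measurable_fun setT XY by exact: measurable_fun_pair.
pose F (z : R * R) := (f z.1 * h z.2)%:E.
have mF : measurable_fun setT F.
  by apply/measurable_EFinP/measurable_funM; exact: measurableT_comp.
have F0 z : (0 <= F z)%E by rewrite lee_fin mulr_ge0.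
pose XYmixin := isMeasurableFun.Build _ _ _ _ _ mXY.
pose XYm : {mfun T >-> (R * R)%type} := HB.pack XY XYmixin.
transitivity (\int[distribution P XYm]_z F z)%E.
  by rewrite ge0_integral_distribution.
transitivity (\int[distribution P X \x distribution P Y]_z F z)%E.
  by apply: eq_measure_integral => A mA _; apply/esym;
    exact: product_measure_unique.
rewrite fubini_tonelli1//= /fubini_F /F/=.
rewrite -[in RHS](ge0_integral_distribution X (f := EFin \o f))//=; last first.
  exact/measurable_EFinP.
rewrite -[in RHS](ge0_integral_distribution Y (f := EFin \o h))//=; last first.
  exact/measurable_EFinP.
rewrite -ge0_integralZr//; first last.
- by apply: integral_ge0 => y _; rewrite lee_fin.
- by move=> x _; rewrite lee_fin.
- exact/measurable_EFinP.
apply: eq_integral => x _.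
under eq_integral => y _ do rewrite EFinM.
rewrite ge0_integralZl//.
- exact/measurable_EFinP.
- by move=> y _; rewrite lee_fin.
- by rewrite lee_fin.
Qed.

(** Laws of random vectors are compared on the sigma-algebra generated by the
    open sets of the column vectors; continuous real functions transfer this
    to the Borel sets of the line. *)
Lemma borel_cV_preimage (R : realType) n (f : 'cV[R]_n -> R) (A : set R) :
  continuous f -> measurable A -> borel_cV (f @^-1` A).
Proof.
move=> cf mA.
have mf : measurable_fun [set: g_sigma_algebraType (@open 'cV[R]_n)]
    (f : _ -> measurableTypeR R).
  apply: (measurability _ (RGenOpens.measurableE R)).
  move=> _ [_ [x [y ->]] <-]; rewrite setTI; apply: sub_sigma_algebra.
  by move/continuousP: cf; apply; exact: interval_open.
by rewrite -[X in borel_cV X]setTI; exact: mf.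
Qed.

(** The orthogonal matrix [[a, b], [b, -a]]. The reflections suffice: they
    contain the exchange of the coordinates and the sign change of the first
    one, and they map any vector to the first axis. *)
Definition reflection2 (R : realType) (a b : R) : 'M[R]_2 :=
  \matrix_(i, j) if i == j then (if i == 0 then a else - a) else b.

Lemma orthogonal_reflection2 (R : realType) (a b : R) :
  a ^+ 2 + b ^+ 2 = 1 -> orthogonal_mx (reflection2 a b).
Proof.
move=> ab; apply/matrixP => i j; rewrite !mxE !big_ord_recl big_ord0 !mxE/=.
case: i => [[|[|//]]] /= i2; case: j => [[|[|//]]] /= j2; rewrite -?ab /=; ring.
Qed.

Section spherical_pair.
Context d (T : measurableType d) (R : realType) (P : probability T R).
Context (X Y : {RV P >-> R}).
Hypothesis sphXY : spherically_symmetric (tnth [tuple X; Y]).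

Lemma reflection_invariant (f : R -> R -> R) (a b : R) (A : set R) :
  continuous (fun v : 'cV[R]_2 => f (v 0 0) (v 1 0)) ->
  a ^+ 2 + b ^+ 2 = 1 -> measurable A ->
  P [set w | A (f (X w) (Y w))] =
  P [set w | A (f (a * X w + b * Y w) (b * X w - a * Y w))].
Proof.
move=> cf ab mA.
have := sphXY (orthogonal_reflection2 ab) (borel_cV_preimage cf mA).
congr (_ = _); congr (P _); apply/funext => w /=; rewrite !mxE//.
rewrite !big_ord_recl !big_ord0 !mxE /=; congr (A (f _ _)).
  by rewrite addr0.
by rewrite addr0 mulNr.
Qed.

Lemma reflection_invariant_integral (f : R -> R -> R) (a b : R) :
  continuous (fun v : 'cV[R]_2 => f (v 0 0) (v 1 0)) ->
  measurable_fun setT (fun z : R * R => f z.1 z.2) ->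
  (forall x y, 0 <= f x y) -> a ^+ 2 + b ^+ 2 = 1 ->
  (\int[P]_w (f (X w) (Y w))%:E =
   \int[P]_w (f (a * X w + b * Y w) (b * X w - a * Y w))%:E)%E.
Proof.
move=> cf mf f0 ab.
have mX : measurable_fun setT X by [].
have mY : measurable_fun setT Y by [].
have mfU : measurable_fun setT (fun w => f (X w) (Y w)).
  exact: (measurableT_comp mf (measurable_fun_pair mX mY)).
have mfV : measurable_fun setT
    (fun w => f (a * X w + b * Y w) (b * X w - a * Y w)).
  have mU : measurable_fun setT (fun w => a * X w + b * Y w).
    by apply: measurable_funD; exact: measurable_funM.
  have mV : measurable_fun setT (fun w => b * X w - a * Y w).
    by apply: measurable_funB; exact: measurable_funM.
  exact: (measurableT_comp mf (measurable_fun_pair mU mV)).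
have intE (Z : T -> R) : measurable_fun setT Z -> (forall w, 0 <= Z w) ->
    (\int[P]_w (Z w)%:E = \int[pushforward P Z]_x `|x|%:E)%E.
  move=> mZ Z0; rewrite ge0_integral_pushforward//=.
    by apply: eq_integral => w _ /=; rewrite ger0_norm.
  by apply/measurable_EFinP; exact: normr_measurable.
rewrite intE// [RHS]intE//.
by apply: eq_measure_integral => A mA _; exact: (reflection_invariant cf ab).
Qed.

Lemma spherical_distribution_eq (A : set R) : measurable A ->
  distribution P X A = distribution P Y A.
Proof.
move=> mA; have a0b1 : 0 ^+ 2 + 1 ^+ 2 = 1 :> R by ring.
have := reflection_invariant (f := fun x _ => x) (@coord_continuous R 2 1 0 0)
  a0b1 mA.
rewrite /distribution /pushforward => ->; congr (P _).
by apply/funext => w /=; rewrite mul0r add0r mul1r.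
Qed.

Lemma spherical_distribution_opp (A : set R) : measurable A ->
  distribution P X A = distribution P X (-%R @^-1` A).
Proof.
move=> mA; have a1b0 : (- 1) ^+ 2 + 0 ^+ 2 = 1 :> R by ring.
have := reflection_invariant (f := fun x _ => x) (@coord_continuous R 2 1 0 0)
  a1b0 mA.
rewrite /distribution /pushforward => ->; congr (P _).
by apply/funext => w /=; rewrite mul0r addr0 mulN1r.
Qed.

Local Notation muX := (distribution P X : probability R R).

(** The reflection which sends [(p, q)] to [(rho, 0)], with [rho] the length of
    [(p, q)], preserves the law of [(X, Y)] and the distance, so it replaces
    the centre [(p, q)] of the Gaussian kernel by [(rho, 0)]. *)
Lemma gauss_avg_radial (t p q : R) : independent_RV2 X Y -> 0 < t ->
  gauss_avg muX t p * gauss_avg muX t q =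
  gauss_avg muX t (Num.sqrt (p ^+ 2 + q ^+ 2)) *
  gauss_avg muX t 0.
Proof.
move=> indep t0.
pose f (p' q' x y : R) :=
  expR (- (t * (x - p') ^+ 2)) * expR (- (t * (y - q') ^+ 2)).
have intf p' q' : (\int[P]_w (f p' q' (X w) (Y w))%:E =
    (gauss_avg muX t p' * gauss_avg muX t q')%:E)%E.
  rewrite (integral_indep_mul indep (measurable_gauss t p')
    (measurable_gauss t q'))//.
  rewrite EFinM -!gauss_avgE ?(ltW t0)//; congr (_ * _)%E.
    rewrite ge0_integral_distribution//.
    by apply/measurable_EFinP; exact: measurable_gauss.
  rewrite (@eq_measure_integral _ _ _ _ (distribution P Y)); last first.
    by move=> A mA _; exact: spherical_distribution_eq.
  rewrite ge0_integral_distribution//.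
  by apply/measurable_EFinP; exact: measurable_gauss.
set rho := Num.sqrt _.
have [rho0|rho_neq0] := eqVneq rho 0.
  have : p ^+ 2 + q ^+ 2 == 0.
    by rewrite eq_le addr_ge0 ?sqr_ge0// andbT -sqrtr_eq0 -/rho rho0.
  by rewrite paddr_eq0 ?sqr_ge0// !sqrf_eq0 rho0 => /andP[/eqP-> /eqP->].
have rho2 : rho ^+ 2 = p ^+ 2 + q ^+ 2.
  by rewrite sqr_sqrtr// addr_ge0 ?sqr_ge0.
have ab1 : (p / rho) ^+ 2 + (q / rho) ^+ 2 = 1.
  by rewrite !expr_div_n -mulrDl -rho2 divff// expf_neq0.
apply: EFin_inj; rewrite -!intf.
have cf : continuous (fun v : 'cV[R]_2 => f p q (v 0 0) (v 1 0)).
  have cg (r : R) (i : 'I_2) :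
      continuous (fun v : 'cV[R]_2 => expR (- (t * (v i 0 - r) ^+ 2))).
    move=> v; apply: (continuous_comp (g := fun x => expR (- (t * (x - r) ^+ 2)))).
      exact: coord_continuous.
    exact: continuous_gauss.
  by move=> v; exact: (continuousM (cg p 0 v) (cg q 1 v)).
have mf : measurable_fun setT (fun z : R * R => f p q z.1 z.2).
  apply: measurable_funM.
    exact: (measurableT_comp (measurable_gauss t p) measurable_fst).
  exact: (measurableT_comp (measurable_gauss t q) measurable_snd).
rewrite (reflection_invariant_integral cf mf _ ab1); last first.
  by move=> x y; rewrite mulr_ge0// expR_ge0.
apply: eq_integral => w _; rewrite /f -!expRD; congr (expR _)%:E.
set a := p / rho in ab1 *; set b := q / rho in ab1 *.
have -> : p = a * rho by rewrite divfK.
have -> : q = b * rho by rewrite divfK.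
(* Multiplying by [a ^+ 2 + b ^+ 2] makes both sides equal as polynomials. *)
rewrite -[RHS]mul1r -ab1; ring.
Qed.

End spherical_pair.

(** * The Laplace transform of the square *)

Section gaussian_laplace.
Context (R : realType) (mu : probability R R).
Implicit Types t x r s : R.

Let L t := gauss_avg mu t 0.

Hypothesis radial : forall t p q, 0 < t ->
  gauss_avg mu t p * gauss_avg mu t q =
  gauss_avg mu t (Num.sqrt (p ^+ 2 + q ^+ 2)) * gauss_avg mu t 0.

Let L0 : L 0 = 1.
Proof.
apply: EFin_inj; rewrite -gauss_avgE//.
under eq_integral => y _ do rewrite mul0r oppr0 expR0.
by rewrite integral_cst// mul1e; exact: probability_setT.
Qed.

(** Both sides come from the integral of [gauss_avg mu t x] against
    [exp (- r * x ^+ 2)], once the Gaussian shape [exp (- a * x ^+ 2)] of the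
    average is known. *)
Let L_scale t : 0 < t -> exists2 a, 0 < a &
  forall r, 0 <= r -> L (t * r / (t + r)) ^+ 2 * (a + r) = L t ^+ 2 * (t + r).
Proof.
move=> t0.
have Lt0 : 0 < L t by apply: gauss_avg_gt0; exact: ltW.
have [a a0 gE] := radial_product_gaussian (fun x => gauss_avg_gt0 mu x (ltW t0))
  (fun x => gauss_avg_le1 mu x (ltW t0)) (fun p q => radial p q t0).
have LE r : 0 <= r -> 0 < a + r ->
    L (t * r / (t + r)) ^+ 2 * (a + r) = L t ^+ 2 * (t + r).
  move=> r0 ar0; have tr0 : 0 < t + r by rewrite ltr_wpDr.
  have := integral_gauss_avg_gauss mu t0 r0.
  have prodE x : gauss_avg mu t x * expR (- (r * x ^+ 2)) =
      L t * expR (- ((a + r) * (x - 0) ^+ 2)).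
    by rewrite gE -mulrA -expRD; congr (_ * expR _); ring.
  under eq_integral => x _ do rewrite prodE EFinM.
  rewrite ge0_integralZl//; first last.
  - by rewrite lee_fin ltW.
  - by apply/measurable_EFinP; exact: measurable_gauss.
  rewrite integral_gauss// -EFinM => -[E0].
  have := congr1 (fun z : R => z ^+ 2) E0.
  rewrite !exprMn !sqr_sqrtr ?divr_ge0 ?pi_ge0 ?(ltW ar0) ?(ltW tr0)//.
  rewrite -/(L _) => E.
  have pi0 : pi != 0 :> R by rewrite gt_eqF// pi_gt0.
  apply: (mulIf pi0).
  apply/eqP; rewrite -subr_eq0; apply/eqP.
  have -> : L (t * r / (t + r)) ^+ 2 * (a + r) * pi =
      (a + r) * (t + r) * (L (t * r / (t + r)) ^+ 2 * (pi / (t + r))).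
    by field; rewrite gt_eqF.
  by rewrite -E; field; rewrite gt_eqF.
have a_gt0 : 0 < a.
  rewrite lt_neqAle a0 andbT eq_sym; apply/eqP => a_eq0.
  have r0 : 0 < L t ^+ 2 * t / 2 by rewrite divr_gt0// mulr_gt0// exprn_gt0.
  (* If [a = 0], the identity and [L <= 1] give [L t ^+ 2 * (t + r) <= r] for
     every [r > 0], which fails for this small [r]. *)
  have := LE _ (ltW r0); rewrite a_eq0 add0r => /(_ r0).
  set r := L t ^+ 2 * t / 2 in r0 *; set l := L _ => E.
  have tr0 : 0 <= t * r / (t + r).
    by rewrite divr_ge0 ?mulr_ge0 ?addr_ge0// ltW.
  have l0 : 0 < l by exact: gauss_avg_gt0.
  have l1 : l <= 1 by exact: gauss_avg_le1.
  have l2 : l ^+ 2 <= 1 by rewrite expr_le1// ltW.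
  have : l ^+ 2 * r <= r by rewrite ger_pMl.
  rewrite E; have := exprn_gt0 2 Lt0; rewrite /r in r0 *; nra.
exists a => // r r0; apply: LE => //; exact: ltr_wpDr.
Qed.

(** The parameter [r] is chosen so that [t * r / (t + r) = s], which reaches
    every [s] below [t]; the case [r = 0] gives [L t ^+ 2 * t = a]. *)
Let L_rational t : 0 < t -> exists c,
  forall s, 0 <= s -> s < t -> L s ^+ 2 * (1 + s * c) = 1.
Proof.
move=> t0; have [a a0 LE] := L_scale t0.
have Lt : L t ^+ 2 * t = a.
  by have := LE 0 (lexx _); rewrite mulr0 mul0r L0 !addr0 expr1n mul1r.
exists (a^-1 - t^-1) => s s0 st.
have ts0 : 0 < t - s by rewrite subr_gt0.
have := LE (t * s / (t - s)); rewrite divr_ge0 ?mulr_ge0 ?(ltW t0) ?(ltW ts0)//.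
move=> /(_ isT).
have -> : t * (t * s / (t - s)) / (t + t * s / (t - s)) = s.
  field; rewrite !gt_eqF//=; nra.
move=> E; apply: (mulIf (lt0r_neq0 a0)); rewrite mul1r -[RHS]Lt.
have -> : L t ^+ 2 * t = L t ^+ 2 * (t + t * s / (t - s)) * (t - s) / t.
  by field; rewrite !gt_eqF.
by rewrite -E; field; rewrite !gt_eqF.
Qed.

(** The constants obtained for different [t] agree, because for [t > 1 / 2]
    each of them is determined by the value of [L] at [1 / 2]. *)
Lemma gauss_avg0_gaussian : exists2 c, 0 <= c &
  forall s, 0 <= s -> gauss_avg mu s 0 = (Num.sqrt (1 + s * c))^-1.
Proof.
pose l := L 2^-1; have l0 : 0 < l by apply: gauss_avg_gt0; rewrite invr_ge0.
have l1 : l <= 1 by apply: gauss_avg_le1; rewrite invr_ge0.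
have l2 : 0 < l ^+ 2 by rewrite exprn_gt0.
pose c := 2 * ((l ^+ 2)^-1 - 1).
have c0 : 0 <= c by rewrite mulr_ge0// subr_ge0 invf_ge1// expr_le1// ltW.
exists c => // s s0.
have s10 : 0 < s + 1 by rewrite ltr_wpDl.
have [c' LE] := L_rational s10.
have cE : c' = c.
  have := LE 2^-1; rewrite invr_ge0 ler0n => /(_ isT).
  have h : 2^-1 < s + 1 by lra.
  move=> /(_ h); rewrite -/l /c => E.
  have -> : (l ^+ 2)^-1 = 1 + 2^-1 * c'.
    by apply: (mulfI (lt0r_neq0 l2)); rewrite divff ?gt_eqF.
  by field.
have := LE _ s0; rewrite ltrDl ltr01 cE => /(_ isT) E.
have sc0 : 0 < 1 + s * c by rewrite ltr_wpDr// mulr_ge0.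
have Ls0 : 0 <= L s by apply/ltW/gauss_avg_gt0.
apply/eqP; rewrite -(eqrXn2 (n := 2))// ?invr_ge0 ?sqrtr_ge0//.
rewrite exprVn sqr_sqrtr ?(ltW sc0)//; apply/eqP.
by apply: (mulIf (lt0r_neq0 sc0)); rewrite mulVf ?gt_eqF.
Qed.

End gaussian_laplace.

(** * Recovering a symmetric law from the Laplace transform of its square *)

Lemma probability_ray_unique (R : realType) (m1 m2 : probability R R) :
  (forall x, m1 `]x, +oo[%classic = m2 `]x, +oo[%classic) ->
  forall A, measurable A -> m1 A = m2 A.
Proof.
move=> m12 A; apply: (measure_unique (@RGenOInfty.G R)
  (fun n => `]- n%:R, +oo[%classic)).
- exact: RGenOInfty.measurableE.
- move=> _ _ [x ->] [y ->]; exists (Num.max x y).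
  by apply/seteqP; split=> z /=; rewrite !in_itv/= !andbT gt_max => /andP.
- by move=> n; eexists.
- rewrite -subTset => x _; exists (Num.bound `|x|) => //=.
  rewrite in_itv/= andbT ltrNl; apply: le_lt_trans (archi_boundP (normr_ge0 x)).
  by rewrite -normrN ler_norm.
- by move=> _ [x ->]; exact: m12.
- by move=> n; rewrite (le_lt_trans (probability_le1 _ _))// ltry.
Qed.

(** Symmetry gives [2 * m A = m A + m (- A)], the integral of the even
    function [\1_A y + \1_A (- y)]. An even function depends on the absolute
    value only, whose law is given by that of the square. *)
Lemma symmetric_probability_unique (R : realType) (m1 m2 : probability R R) :
  (forall A, measurable A -> m1 A = m1 (-%R @^-1` A)) ->
  (forall A, measurable A -> m2 A = m2 (-%R @^-1` A)) ->
  (forall r, 0 <= r -> m1 [set x | r < x ^+ 2] = m2 [set x | r < x ^+ 2]) ->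
  forall A, measurable A -> m1 A = m2 A.
Proof.
move=> sym1 sym2 m12 A mA.
have mnorm : measurable_fun setT (@Num.norm R R) by exact: normr_measurable.
pose nmixin := isMeasurableFun.Build _ _ _ _ _ mnorm.
pose nm : {mfun R >-> R} := HB.pack (@Num.norm R R) nmixin.
have norm12 B : measurable B -> distribution m1 nm B = distribution m2 nm B.
  apply: probability_ray_unique => x.
  rewrite -[LHS]/(m1 (nm @^-1` _)) -[RHS]/(m2 (nm @^-1` _)).
  have [x0|x0] := leP 0 x.
    have -> : nm @^-1` `]x, +oo[%classic = [set y | x ^+ 2 < y ^+ 2].
      apply/seteqP; split=> y /=;
        rewrite in_itv/= andbT -(real_normK (num_real y));
      by rewrite ltr_sqr ?nnegrE.
    by rewrite m12// sqr_ge0.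
  have -> : nm @^-1` `]x, +oo[%classic = setT.
    by rewrite -subTset => y _ /=; rewrite in_itv/= andbT (lt_le_trans x0).
  by rewrite !probability_setT.
have mNA : measurable (-%R @^-1` A).
  by rewrite -[X in measurable X]setTI; exact: oppr_measurable.
pose phi (y : R) : \bar R := ((\1_A y)%:E + (\1_(-%R @^-1` A) y)%:E)%E.
have mphi : measurable_fun setT phi.
  by apply: emeasurable_funD; apply/measurable_EFinP; exact: measurable_indic.
have phiE (m : probability R R) :
    (forall A, measurable A -> m A = m (-%R @^-1` A)) ->
    (m A + m A = \int[distribution m nm]_y phi y)%E.
  move=> sym; rewrite ge0_integral_distribution//; last first.
    by move=> y; rewrite adde_ge0// lee_fin.
  rewrite [X in (_ + X)%E]sym//.
  rewrite -[X in (m X + _)%E]setIT -[X in (_ + m X)%E]setIT -!integral_indic//.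
  rewrite -ge0_integralD//; last 2 first.
  - by apply/measurable_EFinP; exact: measurable_indic.
  - by apply/measurable_EFinP; exact: measurable_indic.
  apply: eq_integral => y _; rewrite /phi/=.
  have [y0|y0] := leP 0 y; first by rewrite ger0_norm.
  rewrite ltr0_norm// addeC; congr (_ + _)%E.
  by rewrite !indicE; congr (nat_of_bool _)%:R%:E; apply/idP/idP;
    rewrite !inE/= opprK.
have fin (m : probability R R) : m A \is a fin_num by rewrite fin_num_measure.
have : (m1 A + m1 A = m2 A + m2 A)%E.
  by rewrite !phiE//; apply: eq_measure_integral => B mB _; exact: norm12.
rewrite -(fineK (fin m1)) -(fineK (fin m2)) -!EFinD => -[E].
congr (_%:E); lra.
Qed.

Section squared_law.
Context (R : realType) (m1 m2 : probability R R).
Hypothesis avg12 : forall s, 0 <= s -> gauss_avg m1 s 0 = gauss_avg m2 s 0.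

(** A linear combination of the functions [exp (- (s + j * m) * x ^+ 2)],
    [j <= k], hence with an integral determined by the Laplace transforms. *)
Let h (m k : nat) (s x : R) :=
  expR (- (s * x ^+ 2)) * (1 - expR (- (m%:R * x ^+ 2))) ^+ k.

Let onem_itv01 (m : nat) (x : R) : 0 <= 1 - expR (- (m%:R * x ^+ 2)) <= 1.
Proof.
have /andP[e0 e1] := gauss_itv01 0 x (ler0n R m); rewrite subr0 in e0 e1.
by rewrite subr_ge0 e1/= gerBl.
Qed.

Let h_itv01 m k s x : 0 <= s -> 0 <= h m k s x <= 1.
Proof.
move=> s0; have /andP[e0 e1] := gauss_itv01 0 x s0; rewrite subr0 in e0 e1.
have /andP[q0 q1] := onem_itv01 m x.
by rewrite mulr_ge0 ?exprn_ge0//= mulr_ile1// ?exprn_ge0// exprn_ile1.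
Qed.

Let mh m k s : measurable_fun setT (h m k s).
Proof.
have mg t : measurable_fun [set: R] (fun x => expR (- (t * x ^+ 2))).
  rewrite (_ : (fun _ => _) = (fun x => expR (- (t * (x - 0) ^+ 2)))).
    exact: measurable_gauss.
  by apply/funext => x; rewrite subr0.
apply: measurable_funM => //; apply: measurable_funX.
exact: measurable_funB.
Qed.

(** Pulling out one factor [1 - exp (- m * x ^+ 2)] writes the function for
    [k + 1] as the difference of those for [k] at [s] and at [s + m]. *)
Let int_h m k s : 0 <= s ->
  (\int[m1]_x (h m k s x)%:E = \int[m2]_x (h m k s x)%:E)%E.
Proof.
elim: k s => [|k IHk] s s0.
  have hE (mu : probability R R) :
      (\int[mu]_x (h m 0 s x)%:E = (gauss_avg mu s 0)%:E)%E.
    by rewrite -gauss_avgE//; apply: eq_integral => x _;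
      rewrite /h expr0 mulr1 subr0.
  by rewrite !hE avg12.
have sm0 : 0 <= s + m%:R by rewrite addr_ge0.
have hE (mu : probability R R) : (\int[mu]_x (h m k.+1 s x)%:E =
    \int[mu]_x (h m k s x)%:E - \int[mu]_x (h m k (s + m%:R) x)%:E)%E.
  rewrite -integralB_EFin//; last 2 first.
  - by apply: integrable_itv01 => // x; exact: h_itv01.
  - by apply: integrable_itv01 => // x; exact: h_itv01.
  apply: eq_integral => x _; rewrite -EFinB; congr _%:E.
  rewrite /h [X in _ * X = _]exprS.
  have -> : - ((s + m%:R) * x ^+ 2) = - (s * x ^+ 2) + - (m%:R * x ^+ 2) by ring.
  by rewrite expRD; ring.
by rewrite !hE !IHk.
Qed.

Let bernoulli_ineq (q : R) k : 0 <= q <= 1 -> 1 - k%:R * q <= (1 - q) ^+ k.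
Proof.
move=> /andP[q0 q1]; elim: k => [|k IHk]; first by rewrite mul0r subr0 expr0.
have q2 : 0 <= q ^+ 2 * k%:R by rewrite mulr_ge0// sqr_ge0.
rewrite exprS -natr1.
have : (1 - q) * (1 - k%:R * q) <= (1 - q) * (1 - q) ^+ k.
  by rewrite ler_wpM2l// subr_ge0.
by apply: le_trans; lra.
Qed.

(** With [m = n + 1] and [q = exp (- m * x ^+ 2)], the power [(1 - q) ^+ k]
    tends to 1 if [k * q] tends to 0 and to 0 if [k * q] tends to infinity. As
    [k] is about [m * exp (m * r)], the product [k * q] is about
    [m * exp (- m * (x ^+ 2 - r))]; the factor [m] decides the case
    [x ^+ 2 = r]. *)
Let kn (r : R) (n : nat) := (Num.truncn (n.+1%:R * expR (n.+1%:R * r))).+1.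

Let h_cvg (r x : R) : 0 <= r ->
  h n.+1 (kn r n) 0 x @[n --> \oo] --> (\1_[set x | r < x ^+ 2] x : R).
Proof.
move=> r0.
suff [C hC] : exists C, forall n,
    `|h n.+1 (kn r n) 0 x - (\1_[set x | r < x ^+ 2] x : R)| <= C * n.+1%:R^-1.
  apply/cvgrPdist_le => e e0.
  have : C * n.+1%:R^-1 @[n --> \oo] --> C * 0.
    by apply: cvgM; [exact: cvg_cst|exact: cvg_harmonic].
  rewrite mulr0 => /cvgrPdist_le /(_ e e0); apply: filterS => n.
  rewrite sub0r normrN distrC => Cn; apply: (le_trans (hC n)).
  by rewrite (le_trans _ Cn)// ler_norm.
have hE n : h n.+1 (kn r n) 0 x = (1 - expR (- (n.+1%:R * x ^+ 2))) ^+ kn r n.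
  by rewrite /h mul0r oppr0 expR0 mul1r.
have kn_gt n : n.+1%:R * expR (n.+1%:R * r) <= (kn r n)%:R.
  exact/ltW/truncnS_gt.
have kn_le n : (kn r n)%:R <= n.+1%:R * expR (n.+1%:R * r) + 1.
  by rewrite -[leLHS]natr1 lerD2r truncn_le// mulr_ge0// expR_ge0.
have [rx|xr] := ltP r (x ^+ 2); last first.
  exists 1 => n; rewrite hE mul1r indicE memNset/=; last first.
    by apply/negP; rewrite -leNgt.
  have /andP[q0 q1] := onem_itv01 n.+1 x.
  rewrite subr0 ger0_norm ?exprn_ge0//.
  set q := expR (- _) in q0 q1 *.
  apply: (@le_trans _ _ (expR (- q) ^+ kn r n)).
    by rewrite lerXn2r ?nnegrE ?expR_ge0//; exact: expR_ge1Dx.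
  rewrite -expRM_natl mulrN expRN lef_pV2 ?posrE ?expR_gt0//.
  apply: (@le_trans _ _ ((kn r n)%:R * q)); last first.
    by apply: le_trans (expR_ge1Dx _); rewrite lerDr.
  apply: (@le_trans _ _ (n.+1%:R * expR (n.+1%:R * r) * q)); last first.
    by rewrite ler_wpM2r// expR_ge0.
  rewrite -mulrA -expRD ler_peMr//.
  by rewrite -[leLHS]expR0 ler_expR subr_ge0 ler_wpM2l.
pose dl := x ^+ 2 - r; have dl0 : 0 < dl by rewrite subr_gt0.
(* The first summand bounds [m * exp (- m * dl)] by means of
   [(m * dl) ^+ 2 / 4 <= exp (m * dl)]; the second bounds the effect of
   rounding up in [kn], at most [exp (- m * x ^+ 2) <= (m * dl)^-1]. *)
exists (4 / dl ^+ 2 + dl^-1) => n; rewrite hE indicE mem_set//=.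
have /andP[q0 q1] := onem_itv01 n.+1 x.
rewrite distrC ger0_norm ?subr_ge0 ?exprn_ile1//.
set q := expR (- _) in q0 q1 *.
have /andP[e0 e1] : 0 <= q <= 1 by rewrite expR_ge0/= -subr_ge0.
rewrite lerBlDl -lerBlDr; apply: le_trans (bernoulli_ineq _ _); last by rewrite e0.
rewrite lerD2l lerN2.
apply: (@le_trans _ _ ((n.+1%:R * expR (n.+1%:R * r) + 1) * q)).
  by rewrite ler_wpM2r.
have n0 : 0 < n.+1%:R :> R by [].
set N := n.+1%:R in n0 q q0 q1 e0 e1 *.
rewrite mulrDl mul1r -mulrA -expRD mulrDl.
have Ndl0 : 0 < N * dl by rewrite mulr_gt0.
apply: lerD.
  have -> : N * r - N * x ^+ 2 = - (N * dl) by rewrite /dl; ring.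
  rewrite expRN ler_pdivrMr ?expR_gt0//.
  have : (1 + N * dl / 2) ^+ 2 <= expR (N * dl).
    have -> : expR (N * dl) = expR (N * dl / 2) ^+ 2.
      by rewrite -expRM_natl; congr expR; field.
    by rewrite lerXn2r ?nnegrE ?expR_ge0 ?expR_ge1Dx// addr_ge0// divr_ge0// ltW.
  move=> H; have H2 : (N * dl) ^+ 2 / 4 <= expR (N * dl).
    by apply: le_trans H; nra.
  apply: le_trans (_ : 4 / dl ^+ 2 / N * ((N * dl) ^+ 2 / 4) <= _).
    by rewrite le_eqVlt; apply/orP; left; apply/eqP; field; rewrite !gt_eqF.
  by rewrite ler_wpM2l// divr_ge0 ?(ltW n0)// divr_ge0// sqr_ge0.
rewrite -invfM mulrC /q expRN lef_pV2 ?posrE ?expR_gt0//.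
apply: le_trans (expR_ge1Dx _); apply: (@le_trans _ _ (N * x ^+ 2)).
  by rewrite ler_pM2l// /dl gerBl.
by rewrite lerDr.
Qed.

(** Dominated convergence along the functions [h], all between 0 and 1. *)
Lemma sq_law_unique (r : R) : 0 <= r ->
  m1 [set x | r < x ^+ 2] = m2 [set x | r < x ^+ 2].
Proof.
move=> r0; set A := [set x | _].
have mA : measurable A.
  have -> : A = (fun x : R => x ^+ 2) @^-1` `]r, +oo[%classic.
    by apply/seteqP; split=> x /=; rewrite in_itv/= andbT.
  by rewrite -[X in measurable X]setTI;
    apply: (measurable_funX 2 (@measurable_id _ _ setT)).
have lim (mu : probability R R) :
    (\int[mu]_x (h n.+1 (kn r n) 0 x)%:E @[n --> \oo] --> mu A)%E.
  have [] := @dominated_convergence _ _ R mu setT measurableT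
    (fun n x => (h n.+1 (kn r n) 0 x)%:E) (fun x => (\1_A x)%:E) (cst 1%E).
  - by move=> n; apply/measurable_EFinP; exact: mh.
  - by apply/measurable_EFinP; exact: measurable_indic.
  - by apply: aeW => x _; apply: cvg_EFin; [near=> n|exact: h_cvg].
  - by apply: (integrable_itv01 mu (f := cst 1)) => // x; rewrite ler01 lexx.
  - apply: aeW => x n _; rewrite /= lee_fin.
    by have /andP[a b] := h_itv01 n.+1 (kn r n) x (lexx 0); rewrite ger0_norm.
  by move=> _ _; rewrite integral_indic// setIT.
apply: (cvg_unique _ (lim m1)); first exact: ereal_hausdorff.
rewrite (_ : (fun n => _) =
    (fun n => \int[m2]_x (h n.+1 (kn r n) 0 x)%:E)%E); first exact: lim.
by apply/funext => n; exact: int_h.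
Unshelve. all: by end_near. Qed.

End squared_law.

(** * Centred normal laws *)

(** The density coincides almost everywhere with the Radon-Nikodym derivative,
    for which the change of variables is known. *)
Lemma integral_normal_prob (R : realType) (m s : R)
    (f : measurableTypeR R -> \bar R) :
  (normal_prob m s).-integrable setT f ->
  (\int[normal_prob m s]_x f x =
   \int[lebesgue_measure]_x (f x * (normal_pdf m s x)%:E))%E.
Proof.
move=> intf.
have mf : measurable_fun setT f by exact: measurable_int intf.
rewrite -(Radon_Nikodym_change_of_variables (normal_prob_dominates m s))//.
apply: ae_eq_integral => //.
- by apply: emeasurable_funM => //; apply: (measurable_int lebesgue_measure);
    apply: Radon_Nikodym_integrable; exact: normal_prob_dominates.
- apply: emeasurable_funM => //; apply/measurable_EFinP.
  exact: measurable_normal_pdf.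
- apply: ae_eqe_mul2l.
  rewrite Radon_NikodymE//=; first exact: normal_prob_dominates.
  move=> dom; case: cid => /= g [g1 g2 g3].
  apply: integral_ae_eq => //.
    by apply/measurable_EFinP; exact: measurable_normal_pdf.
  by move=> E _ mE; rewrite -g3.
Qed.

(** The two measurable structures on the line, [measurableTypeR R] and the
    canonical one of [R], have the same measurable sets but are not convertible;
    the law of this variable transports a probability from the first to the
    second. *)
Definition real_id (R : realType) : measurableTypeR R -> R := idfun.

HB.instance Definition _ (R : realType) :=
  @isMeasurableFun.Build _ _ (measurableTypeR R) R (@real_id R)
    (@measurable_id _ _ setT).

Section normal_law_properties.
Context (R : realType) (v : R) (v0 : 0 <= v).

Local Notation nu :=
  (distribution (normal_law 0 v) (@real_id R) : probability R R).

Lemma gauss_avg_normal_law (s : R) : 0 <= s ->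
  gauss_avg nu s 0 = (Num.sqrt (1 + s * (v *+ 2)))^-1.
Proof.
move=> s0; apply: EFin_inj; rewrite -gauss_avgE//.
rewrite ge0_integral_distribution//; last first.
  by apply/measurable_EFinP; exact: measurable_gauss.
rewrite /normal_law; have [->|v_neq0] := eqVneq v 0.
  rewrite integral_dirac//; last first.
    by apply/measurable_EFinP; exact: measurable_gauss.
  rewrite diracT mul1e /=.
  rewrite /real_id/= subr0 expr0n mulr0 oppr0 expR0.
  by rewrite mul0rn mulr0 addr0 sqrtr1 invr1.
have v_gt0 : 0 < v by rewrite lt_neqAle eq_sym v_neq0.
have sv0 : Num.sqrt v != 0 by rewrite gt_eqF// sqrtr_gt0.
have intg : (normal_prob 0 (Num.sqrt v)).-integrable setT
    (fun x : measurableTypeR R => (expR (- (s * (x - 0) ^+ 2)))%:E).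
  apply: integrable_itv01; first exact: measurable_gauss.
  by move=> x; exact: gauss_itv01.
rewrite [LHS](integral_normal_prob intg).
have w0 : 0 < s + (v *+ 2)^-1 by rewrite ltr_wpDl// invr_gt0 mulrn_wgt0.
have prodE x : expR (- (s * (x - 0) ^+ 2)) * normal_pdf 0 (Num.sqrt v) x =
    normal_peak (Num.sqrt v) * expR (- ((s + (v *+ 2)^-1) * (x - 0) ^+ 2)).
  rewrite normal_pdfE// /normal_fun sqr_sqrtr// mulrCA -expRD.
  by congr (_ * expR _); rewrite mulNr; ring.
under eq_integral => x _ do rewrite -EFinM prodE EFinM.
rewrite ge0_integralZl//; first last.
- by rewrite lee_fin normal_peak_ge0.
- by apply/measurable_EFinP; exact: measurable_gauss.
rewrite integral_gauss// -EFinM; congr _%:E.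
rewrite /normal_peak sqr_sqrtr//.
rewrite -sqrtrV ?mulrn_wge0 ?mulr_ge0 ?pi_ge0//.
rewrite -sqrtrM ?invr_ge0 ?mulrn_wge0 ?mulr_ge0 ?pi_ge0//.
rewrite -sqrtrV ?addr_ge0 ?mulr_ge0 ?mulrn_wge0//; congr Num.sqrt.
have p0 : pi != 0 :> R by rewrite gt_eqF// pi_gt0.
have sv1 : 1 + s * (v * 2) != 0.
  by rewrite gt_eqF// ltr_wpDr// mulr_ge0// mulr_ge0.
rewrite -(mulr_natr v) -(mulr_natr (v * pi)); move: (pi : R) p0 => p p0.
have -> : s + (v * 2)^-1 = (1 + s * (v * 2)) / (v * 2).
  by field; rewrite v_neq0.
by field; rewrite v_neq0 p0 sv1.
Qed.

(** By uniqueness it is enough to compare the half-lines, where the substitution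
    [y |-> - y] applies to the even density. *)
Lemma normal_law_opp (A : set R) : measurable A -> nu A = nu (-%R @^-1` A).
Proof.
have mopp : measurable_fun setT (-%R : R -> R) by exact: oppr_measurable.
pose omixin := isMeasurableFun.Build _ _ _ _ _ mopp.
pose om : {mfun R >-> R} := HB.pack (-%R : R -> R) omixin.
move=> mA; apply: (probability_ray_unique (m2 := distribution nu om)) => // x.
rewrite -[LHS]/(normal_law 0 v `]x, +oo[%classic).
rewrite -[RHS]/(normal_law 0 v (-%R @^-1` `]x, +oo[%classic)).
have -> : -%R @^-1` `]x, +oo[%classic = `]-oo, - x[%classic :> set R.
  by apply/seteqP; split=> y /=; rewrite !in_itv/= andbT ltrNr.
rewrite /normal_law; have [_|v_neq0] := eqVneq v 0.
  rewrite -[LHS]/(@dirac _ (measurableTypeR R) 0 R _).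
  rewrite -[RHS]/(@dirac _ (measurableTypeR R) 0 R _) !diracE; congr (nat_of_bool _)%:R%:E.
  by apply/idP/idP; rewrite !inE/= !in_itv/= andbT ltrNr oppr0.
have sv0 : Num.sqrt v != 0.
  by rewrite gt_eqF// sqrtr_gt0 lt_neqAle eq_sym v_neq0.
rewrite /= /normal_prob.
have mpdf : measurable_fun setT (fun x : R => (normal_pdf 0 (Num.sqrt v) x)%:E).
  by apply/measurable_EFinP; exact: measurable_normal_pdf.
rewrite integral_itv_obnd_cbnd; last exact: measurable_funTS.
rewrite integral_itv_bndo_bndc; last exact: measurable_funTS.
rewrite ge0_integration_by_substitutionNy//.
- apply: eq_integral => y _; congr _%:E.
  by rewrite /= !normal_pdfE// /normal_fun !subr0 sqrrN.
- exact/continuous_subspaceT/continuous_normal_pdf.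
- by move=> y _; exact: normal_pdf_ge0.
Qed.

End normal_law_properties.

Unset Implicit Arguments.

(** * Independent coordinates of a spherically symmetric vector *)

Theorem theorem3p2 (d : measure_display) (T : measurableType d) (R : realType)
    (P : probability T R) (X Y : {RV P >-> R})
    (indepXY : independent_RV2 X Y)
    (sphXY : spherically_symmetric (tnth [tuple X; Y])) :
  exists v : R,
    [/\ 0 <= v, has_distribution X (normal_law 0 v)
      & has_distribution Y (normal_law 0 v)].
Proof.
have [c c0 XE] := gauss_avg0_gaussian
  (fun t p q => @gauss_avg_radial _ _ _ _ _ _ sphXY t p q indepXY).
have v0 : 0 <= c / 2 by rewrite divr_ge0.
have Xnormal : has_distribution X (normal_law 0 (c / 2)).
  apply: (@symmetric_probability_unique R (distribution P X)
    (distribution (normal_law 0 (c / 2)) (@real_id R))).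
  - by move=> A mA; exact: (spherical_distribution_opp sphXY).
  - by move=> A mA; exact: normal_law_opp.
  - apply: sq_law_unique => s s0.
    rewrite XE// gauss_avg_normal_law//; congr (Num.sqrt (_ + s * _))^-1.
    by rewrite -mulr_natr; field.
exists (c / 2); split => // A mA.
by rewrite -(spherical_distribution_eq sphXY)//; exact: Xnormal.
Qed.
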